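(* Let $(\lambda,x_R)$ be a simple eigenpair of $A\in\mathbb{C}^{n\times n}$, let $\theta_m\in\mathbb{C}$, and suppose $|\lambda-\theta_m|<\sigma_{\min}(A_{22}-\theta_mI)$, where $A_{22}$ is the deflated block of $A$ at $\lambda$. If $V_m$ is sketch-orthonormal and $S$ is an $\epsilon$-subspace embedding for $\operatorname{span}([V_m,AV_m])$ with $\epsilon\in(0,1)$, then the sketched refined vector $u_m^{\mathrm{ref}}=V_mc_m$, $c_m\in\operatorname{argmin}_{\|c\|=1}\|S(A-\theta_mI)V_mc\|$, satisfies $$\sin\angle(x_R,u_m^{\mathrm{ref}})\le\frac{1+\epsilon}{\sqrt{1-\epsilon}}\;\kappa_2([x_R,X_\perp])\;\frac{\min_{\|c\|=1}\|(A-\theta_mI)V_mc\|}{\sigma_{\min}(A_{22}-\theta_mI)}.$$ Hence, along a sequence in $m$ for which these hypotheses hold, $\sin\angle(x_R,u_m^{\mathrm{ref}})\to0$ whenever $\min_{\|c\|=1}\|(A-\theta_mI)V_mc\|\to0$; no uniform separation condition on the projected problem is needed.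
   Context: $\|\cdot\|$ is the Euclidean/spectral norm; $\kappa_2(\cdot)=\sigma_{\max}/\sigma_{\min}$; $\operatorname{span}(V)$ is the column space. For nonzero vectors $x,u$, $\sin\angle(x,u)=\min_{t\in\mathbb{C}}\|x-tu\|/\|x\|$. $\lambda$ is a simple eigenvalue of $A$ with unit right eigenvector $x_R$ ($Ax_R=\lambda x_R$) and unit left eigenvector $x_L$ ($x_L^*A=\lambda x_L^*$). $X_\perp\in\mathbb{C}^{n\times(n-1)}$ has orthonormal columns spanning the complementary invariant subspace $\operatorname{span}(x_L)^\perp$, and the deflated block is $A_{22}=X_\perp^*AX_\perp$, so $AX_\perp=X_\perp A_{22}$. $S\in\mathbb{C}^{s\times n}$ is an $\epsilon$-subspace embedding for a subspace $\mathcal V$ if $(1-\epsilon)\|u\|^2\le\|Su\|^2\le(1+\epsilon)\|u\|^2$ for all $u\in\mathcal V$. $V$ is sketch-orthonormal if $(SV)^*(SV)=I$. *)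

(* Defs.v *)
From mathcomp Require Import all_boot all_order all_algebra.
From mathcomp Require Import all_classical all_reals all_analysis.
From mathcomp Require Import complex.

Set Implicit Arguments.
Unset Strict Implicit.
Unset Printing Implicit Defensive.

Import Order.TTheory GRing.Theory Num.Theory.
Import numFieldNormedType.Exports.

Local Open Scope classical_set_scope.
Local Open Scope ring_scope.

(* The modulus as an element of [R]; the generic norm `|z| of [R[i]] takes its
   values in [R[i]]. *)
Definition cmod (R : realType) (z : R[i]) : R := ComplexField.Normc.normc z.

Definition adjoint (R : realType) (m n : nat) (M : 'M[R[i]]_(m, n)) :
  'M[R[i]]_(n, m) := M^t*%sesqui.

(* The norm MathComp-Analysis puts on matrices is the max norm, so the
   Euclidean one is defined here. *)
Definition norm2 (R : realType) (n : nat) (v : 'cV[R[i]]_n) : R :=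
  Num.sqrt (\sum_(i < n) cmod (v i 0) ^+ 2).

(* Square matrices only: for a wide matrix, the spectrum of M^* M would
   contain additional zeros. *)
Definition singular_values (R : realType) (n : nat) (M : 'M[R[i]]_n) : set R :=
  [set s | 0 <= s /\ eigenvalue (adjoint M *m M) (s ^+ 2)%:C%C].

(* The set of singular values is finite, and nonempty for n > 0, so that inf
   and sup are its minimum and maximum.  For n = 0 both are 0. *)
Definition sigma_min (R : realType) (n : nat) (M : 'M[R[i]]_n) : R :=
  inf (singular_values M).

Definition sigma_max (R : realType) (n : nat) (M : 'M[R[i]]_n) : R :=
  sup (singular_values M).

Definition kappa2 (R : realType) (n : nat) (M : 'M[R[i]]_n) : R :=
  sigma_max M / sigma_min M.

Definition colspan (R : realType) (m n : nat) (M : 'M[R[i]]_(m, n)) :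
  set 'cV[R[i]]_m := range (fun y : 'cV[R[i]]_n => M *m y).

Definition orthogonal_complement (R : realType) (n : nat) (x : 'cV[R[i]]_n) :
  set 'cV[R[i]]_n := [set v | adjoint x *m v = 0].

(* The minimum over t in C is attained, hence equal to the infimum. *)
Definition sin_angle (R : realType) (n : nat) (x u : 'cV[R[i]]_n) : R :=
  inf (range (fun t : R[i] => norm2 (x - t *: u))) / norm2 x.

Definition simple_eigenvalue (R : realType) (n : nat) (A : 'M[R[i]]_n)
  (lambda : R[i]) : Prop := mup lambda (char_poly A) = 1%N.

Definition orthonormal_columns (R : realType) (m n : nat)
  (M : 'M[R[i]]_(m, n)) : Prop := adjoint M *m M = 1%:M.

Definition deflated_block (R : realType) (n k : nat) (A : 'M[R[i]]_n)
  (X : 'M[R[i]]_(n, k)) : 'M[R[i]]_k := adjoint X *m A *m X.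

Definition subspace_embedding (R : realType) (s n : nat)
  (S : 'M[R[i]]_(s, n)) (eps : R) (U : set 'cV[R[i]]_n) : Prop :=
  forall u, U u ->
    (1 - eps) * norm2 u ^+ 2 <= norm2 (S *m u) ^+ 2 <= (1 + eps) * norm2 u ^+ 2.

Definition sketch_orthonormal (R : realType) (s n k : nat)
  (S : 'M[R[i]]_(s, n)) (V : 'M[R[i]]_(n, k)) : Prop :=
  orthonormal_columns (S *m V).

Definition unit_sphere (R : realType) (k : nat) : set 'cV[R[i]]_k :=
  [set c | norm2 c = 1].

(* min_{||c|| = 1} ||M c||: for k > 0 the sphere is nonempty and compact, so the
   infimum is attained. *)
Definition min_on_sphere (R : realType) (m k : nat) (M : 'M[R[i]]_(m, k)) : R :=
  inf [set norm2 (M *m c) | c in @unit_sphere R k].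

Definition argmin_on_sphere (R : realType) (m k : nat) (M : 'M[R[i]]_(m, k)) :
  set 'cV[R[i]]_k :=
  [set c | unit_sphere c /\
    forall c', unit_sphere c' -> norm2 (M *m c) <= norm2 (M *m c')].

(* Main.v *)
(** Sketch-orthonormality of V and the embedding property give
    ||(A - theta)u|| / ||u|| <= (1 + eps)/sqrt(1 - eps) min ||(A - theta)Vc||.
    Expand u = a xR + Xperp y, so that (A - theta)u has coordinates
    (a (lambda - theta), (A22 - theta)y) in the basis [xR, Xperp].  Hence
    ||y|| <= ||(A - theta)u|| / (sigma_min [xR, Xperp] sigma_min (A22 - theta)),
    and ||y|| / ||u|| bounds the sine of the angle, while sigma_max [xR, Xperp]
    is at least ||xR|| = 1.  That [xR, Xperp] is a basis comes from the gap
    condition, which prevents lambda from being an eigenvalue of A22.  The same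
    condition gives sigma_min (A22 - lambda) <= 2 sigma_min (A22 - theta), a
    bound below that is uniform in theta, whence the convergence. *)

Require Import Defs.
From mathcomp Require Import all_boot all_order all_algebra.
From mathcomp Require Import all_classical all_reals all_analysis.
From mathcomp Require Import complex ring lra.
Import Order.TTheory GRing.Theory Num.Theory.
Import numFieldNormedType.Exports.
Local Open Scope classical_set_scope.
Local Open Scope ring_scope.

(** * Hermitian inner product, Euclidean norm and angle *)

Section Euclidean.
Context {R : realType}.
Implicit Types (m n k : nat).

Definition cdot {n} (u v : 'cV[R[i]]_n) : R[i] := (adjoint u *m v) 0 0.

Lemma adjointM m n k (M : 'M[R[i]]_(m, n)) (N : 'M[R[i]]_(n, k)) :
  adjoint (M *m N) = adjoint N *m adjoint M.
Proof. by rewrite /adjoint trmx_mul map_mxM. Qed.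

Lemma adjointK m n (M : 'M[R[i]]_(m, n)) : adjoint (adjoint M) = M.
Proof. exact: trmxCK. Qed.

Lemma cdotE n (u v : 'cV[R[i]]_n) : cdot u v = \sum_i (u i 0)^* * v i 0.
Proof. by rewrite /cdot mxE; apply: eq_bigr => i _; rewrite !mxE. Qed.

Lemma cdotC n (u v : 'cV[R[i]]_n) : cdot u v = (cdot v u)^*.
Proof.
rewrite !cdotE rmorph_sum; apply: eq_bigr => i _.
by rewrite rmorphM /= conjCK mulrC.
Qed.

Lemma cdotDr n (u v w : 'cV[R[i]]_n) : cdot u (v + w) = cdot u v + cdot u w.
Proof. by rewrite /cdot mulmxDr mxE. Qed.

Lemma cdotZr n a (u v : 'cV[R[i]]_n) : cdot u (a *: v) = a * cdot u v.
Proof. by rewrite /cdot -scalemxAr mxE. Qed.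

Lemma cdotDl n (u v w : 'cV[R[i]]_n) : cdot (u + v) w = cdot u w + cdot v w.
Proof. by rewrite cdotC cdotDr rmorphD /= -!cdotC. Qed.

Lemma cdotZl n a (u v : 'cV[R[i]]_n) : cdot (a *: u) v = a^* * cdot u v.
Proof. by rewrite cdotC cdotZr rmorphM /= -!cdotC. Qed.

Lemma cmodE (z : R[i]) : (cmod z)%:C%C = `|z|.
Proof. by case: z. Qed.

Lemma cmod_ge0 (z : R[i]) : 0 <= cmod z.
Proof. by case: z => a b; exact: sqrtr_ge0. Qed.

Lemma cmod_sqE (z : R[i]) : (cmod z ^+ 2)%:C%C = z^* * z.
Proof. by rewrite rmorphXn /= cmodE normCK mulrC. Qed.

Lemma norm2_ge0 n (v : 'cV[R[i]]_n) : 0 <= norm2 v.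
Proof. exact: sqrtr_ge0. Qed.

Lemma norm2_sq n (v : 'cV[R[i]]_n) :
  norm2 v ^+ 2 = \sum_(i < n) cmod (v i 0) ^+ 2.
Proof. by rewrite sqr_sqrtr// sumr_ge0// => i _; rewrite sqr_ge0. Qed.

Lemma norm2_cdot n (v : 'cV[R[i]]_n) : (norm2 v ^+ 2)%:C%C = cdot v v.
Proof.
rewrite norm2_sq cdotE rmorph_sum /=; apply: eq_bigr => i _; exact: cmod_sqE.
Qed.

Lemma norm2_0 n : norm2 (0 : 'cV[R[i]]_n) = 0.
Proof.
apply/eqP; rewrite -sqrf_eq0 norm2_sq big1// => i _.
by rewrite mxE /cmod ComplexField.Normc.normc0 expr0n.
Qed.

Lemma norm2_eq0 n (v : 'cV[R[i]]_n) : (norm2 v == 0) = (v == 0).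
Proof.
apply/idP/idP => [|/eqP->]; last by rewrite norm2_0.
rewrite -sqrf_eq0 norm2_sq psumr_eq0 => [/allP v0|i _]; last exact: sqr_ge0.
apply/eqP/matrixP => i j; rewrite ord1 mxE.
have := v0 i (mem_index_enum _).
by rewrite sqrf_eq0 => /eqP /ComplexField.Normc.eq0_normc.
Qed.

Lemma norm2_gt0 n (v : 'cV[R[i]]_n) : (0 < norm2 v) = (v != 0).
Proof. by rewrite lt_neqAle norm2_ge0 eq_sym norm2_eq0 andbT. Qed.

Lemma norm2Z n a (v : 'cV[R[i]]_n) : norm2 (a *: v) = cmod a * norm2 v.
Proof.
apply/eqP; rewrite -(@eqrXn2 _ 2)// ?mulr_ge0 ?norm2_ge0 ?cmod_ge0//.
apply/eqP; apply: complexI.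
by rewrite norm2_cdot cdotZl cdotZr mulrA -cmod_sqE -norm2_cdot exprMn -rmorphM.
Qed.

Lemma norm2_isometry m n (Q : 'M[R[i]]_(m, n)) (v : 'cV_n) :
  orthonormal_columns Q -> norm2 (Q *m v) = norm2 v.
Proof.
move=> QQ; apply/eqP; rewrite -(@eqrXn2 _ 2)// ?norm2_ge0//.
apply/eqP; apply: complexI; rewrite !norm2_cdot /cdot adjointM.
by rewrite mulmxA -(mulmxA _ _ Q) QQ mulmx1.
Qed.

(** Plays the part of the triangle inequality in [sigma_min_deflated_ge]: dropping one square bounds
    the other by twice the sum of the squared norms. *)
Lemma norm2_parallelogram n (u v : 'cV[R[i]]_n) :
  norm2 (u + v) ^+ 2 + norm2 (u - v) ^+ 2 = 2 * (norm2 u ^+ 2 + norm2 v ^+ 2).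
Proof.
apply: complexI; rewrite rmorphM !rmorphD /= !norm2_cdot -scaleN1r.
rewrite !(cdotDl, cdotDr, cdotZl, cdotZr) rmorphN1 rmorph1; ring.
Qed.

Lemma norm2_col_mx m n (u : 'cV[R[i]]_m) (v : 'cV_n) :
  norm2 (col_mx u v) ^+ 2 = norm2 u ^+ 2 + norm2 v ^+ 2.
Proof.
rewrite !norm2_sq big_split_ord /=.
by congr (_ + _); apply: eq_bigr => i _; rewrite ?col_mxEu ?col_mxEd.
Qed.

(* The orthogonal projection of [x] on the line of [u] is at the same distance
   from [x], relatively to the norms, as that of [u] on the line of [x] is from
   [u]; this symmetry of the angle lets [alpha] multiply [x]. *)
Lemma sin_angle_le n (x u : 'cV[R[i]]_n) (alpha : R[i]) :
  norm2 x = 1 -> u != 0 -> sin_angle x u <= norm2 (u - alpha *: x) / norm2 u.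
Proof.
move=> x1 u0; rewrite /sin_angle x1 divr1.
have U0 : 0 < norm2 u by rewrite norm2_gt0.
have cU0 : cdot u u != 0.
  by rewrite -norm2_cdot -[0]/(0%:C%C) (inj_eq (@complexI _)) sqrf_eq0 gt_eqF.
pose t := cdot u x / cdot u u.
apply: (@le_trans _ _ (norm2 (x - t *: u))).
  apply: ge_inf; last by exists t.
  by exists 0 => _ [s _ <-]; exact: norm2_ge0.
rewrite ler_pdivlMr// -(@ler_pXn2r _ 2)// ?nnegrE ?mulr_ge0 ?norm2_ge0//.
rewrite exprMn -lecR rmorphM /= !norm2_cdot -subr_ge0.
have xx : cdot x x = 1 by rewrite -norm2_cdot x1 expr1n.
have tu : cdot u x = t * cdot u u by rewrite divfK.
have tu' : cdot x u = t^* * cdot u u by rewrite cdotC tu rmorphM /= -cdotC.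
clearbody t.
(* After scaling by the squared norm of [u], the distance from [x] to the line of [u] equals the
   distance from [u] to the line of [x]; by Pythagoras, the excess at [alpha] is the squared modulus
   of [alpha - cdot x u]. *)
suff -> : cdot (u - alpha *: x) (u - alpha *: x) -
   cdot (x - t *: u) (x - t *: u) * cdot u u =
   (alpha - cdot x u) * (alpha - cdot x u)^* by rewrite -normCK exprn_ge0.
rewrite -(scaleNr alpha x) -(scaleNr t u) !(cdotDl, cdotDr, cdotZl, cdotZr).
rewrite !rmorphD !rmorphN /= xx.
rewrite -[(cdot x u)^*]cdotC tu tu'; ring.
Qed.


(** * Singular values and the extremal properties of [sigma_min] and [sigma_max] *)

Lemma cdot_diag n (d : 'rV[R[i]]_n) (v : 'cV[R[i]]_n) :
  cdot v (diag_mx d *m v) = \sum_i d 0 i * (cmod (v i 0) ^+ 2)%:C%C.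
Proof.
rewrite cdotE; apply: eq_bigr => i _; rewrite cmod_sqE mul_diag_mx mxE.
by rewrite mulrCA.
Qed.

Lemma norm2_mul_sq m n (M : 'M[R[i]]_(m, n)) (v : 'cV_n) :
  (norm2 (M *m v) ^+ 2)%:C%C = cdot v (adjoint M *m M *m v).
Proof. by rewrite norm2_cdot /cdot adjointM !mulmxA. Qed.

(** [eigenvalue] speaks of row vectors, so the witness is the normalized adjoint of a left
    eigenvector of [adjoint M *m M]. *)
Lemma singular_valueP n (M : 'M[R[i]]_n) (s : R) : singular_values M s ->
  exists2 w : 'cV[R[i]]_n, norm2 w = 1 & norm2 (M *m w) = s.
Proof.
move=> [s0 /eigenvalueP[v vM v0]]; pose w := adjoint v.
have w0 : w != 0.
  apply: contra v0 => /eqP w0; rewrite -[v]adjointK -/w w0.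
  by rewrite /adjoint trmx0 map_mx0.
have nw0 : norm2 w != 0 by rewrite norm2_eq0.
have Mw : norm2 (M *m w) = s * norm2 w.
  apply/eqP; rewrite -(@eqrXn2 _ 2)// ?mulr_ge0 ?norm2_ge0//; apply/eqP.
  apply: complexI; rewrite norm2_mul_sq /cdot mulmxA adjointK vM -scalemxAl.
  rewrite mxE exprMn; have -> : (v *m w) 0 0 = (norm2 w ^+ 2)%:C%C.
    by rewrite norm2_cdot /cdot adjointK.
  by rewrite -rmorphM.
have cw : cmod (norm2 w)^-1%:C%C = (norm2 w)^-1.
  by rewrite /cmod /= expr0n addr0 sqrtr_sqr ger0_norm// invr_ge0 norm2_ge0.
exists ((norm2 w)^-1%:C%C *: w); first by rewrite norm2Z cw mulVf.
by rewrite -scalemxAr norm2Z cw Mw mulrC mulfK.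
Qed.

(** The right half of an SVD. The matrix [adjoint M *m M] is Hermitian, hence normal, and the
    spectral theorem provides a unitary [P] whose rows are left eigenvectors; [d i] is the norm of
    the image under [M] of the adjoint of row [i]. In the coordinates [P *m y], bounds on the [d i]
    become bounds on [M]. *)
Lemma singular_decomposition n (M : 'M[R[i]]_n) :
  exists (P : 'M[R[i]]_n) (d : 'I_n -> R),
  [/\ orthonormal_columns P, forall i, singular_values M (d i) &
      forall y, norm2 (M *m y) ^+ 2 =
        \sum_i d i ^+ 2 * cmod ((P *m y) i 0) ^+ 2].
Proof.
pose H := adjoint M *m M.
have Hnorm : H \is normalmx.
  by apply/normalmxP; rewrite -[(H^t*)%sesqui]/(adjoint H) adjointM adjointK.
have HE := orthomx_spectralP Hnorm.
have Pu := spectral_unitarymx H.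
set P := spectralmx H in HE Pu; set D := spectral_diag H in HE.
have PP : P *m adjoint P = 1%:M by exact/unitarymxP.
have PP' : adjoint P *m P = 1%:M by exact: mulmx1C.
have PH : P *m H = diag_mx D *m P.
  rewrite [LHS](congr1 (mulmx P) HE) !mulmxA.
  by rewrite (mulmxV (unitarymx_unit Pu)) mul1mx.
have rr i : (row i P *m adjoint (row i P)) 0 0 = 1.
  transitivity ((P *m adjoint P) i i); last by rewrite PP mxE eqxx.
  by rewrite !mxE; apply: eq_bigr => j _; rewrite !mxE.
have nr i : norm2 (adjoint (row i P)) = 1.
  apply/eqP; rewrite -(@eqrXn2 _ 2)// ?norm2_ge0//; apply/eqP.
  by apply: complexI; rewrite norm2_cdot /cdot adjointK rr expr1n.
have rH i : row i P *m H = D 0 i *: row i P.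
  by rewrite -row_mul PH; apply/rowP => j; rewrite mul_diag_mx !mxE.
pose d i := norm2 (M *m adjoint (row i P)).
have dD i : (d i ^+ 2)%:C%C = D 0 i.
  rewrite norm2_mul_sq /cdot mulmxA adjointK rH -scalemxAl mxE rr.
  exact: mulr1.
exists P, d; split=> // [i|y].
  split; first exact: norm2_ge0.
  apply/eigenvalueP; exists (row i P); first by rewrite dD rH.
  apply/eqP => Pi0; have /eqP := nr i.
  by rewrite Pi0 /adjoint trmx0 map_mx0 norm2_0 eq_sym oner_eq0.
apply: complexI; rewrite norm2_mul_sq -/H.
have -> : H = adjoint P *m diag_mx D *m P.
  by rewrite -mulmxA -PH mulmxA PP' mul1mx.
have -> : cdot y (adjoint P *m diag_mx D *m P *m y) =
    cdot (P *m y) (diag_mx D *m (P *m y)) by rewrite /cdot adjointM !mulmxA.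
rewrite cdot_diag rmorph_sum /=; apply: eq_bigr => i _.
by rewrite -dD -rmorphM.
Qed.

Lemma singular_values_ge0 n (M : 'M[R[i]]_n) : lbound (singular_values M) 0.
Proof. by move=> s []. Qed.

Lemma has_lbound_singular_values n (M : 'M[R[i]]_n) :
  has_lbound (singular_values M).
Proof. by exists 0; exact: singular_values_ge0. Qed.

Lemma has_ubound_singular_values n (M : 'M[R[i]]_n) :
  has_ubound (singular_values M).
Proof.
have [P [d [PP dM Md]]] := singular_decomposition n M.
have d0 i : 0 <= d i by have [] := dM i.
(* The sum of the [d i] is a crude bound, but any bound is enough to make [sup] a genuine
   supremum. *)
exists (\sum_i d i) => _ /singular_valueP[w w1 <-].
rewrite -(@ler_pXn2r _ 2)// ?nnegrE ?norm2_ge0 ?sumr_ge0// Md.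
have -> : (\sum_i d i) ^+ 2 =
    \sum_i (\sum_j d j) ^+ 2 * cmod ((P *m w) i 0) ^+ 2.
  by rewrite -mulr_sumr -norm2_sq norm2_isometry// w1 expr1n mulr1.
apply: ler_sum => i _; rewrite ler_wpM2r ?sqr_ge0//.
rewrite ler_pXn2r ?nnegrE ?sumr_ge0//.
by rewrite (bigD1 i)//= lerDl sumr_ge0.
Qed.

Lemma sigma_min_ge0 n (M : 'M[R[i]]_n) : 0 <= sigma_min M.
Proof.
(* An empty set of singular values has [inf] equal to 0 by convention. *)
have [M0|/set0P S0] := eqVneq (singular_values M) set0.
  by rewrite /sigma_min M0 inf0.
by rewrite lb_le_inf//; exact: singular_values_ge0.
Qed.

Lemma sigma_min_le n (M : 'M[R[i]]_n) (y : 'cV_n) :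
  sigma_min M * norm2 y <= norm2 (M *m y).
Proof.
have [P [d [PP dM Md]]] := singular_decomposition n M.
rewrite -(@ler_pXn2r _ 2)// ?nnegrE ?mulr_ge0 ?sigma_min_ge0 ?norm2_ge0//.
rewrite Md exprMn -(norm2_isometry _ _ _ y PP) norm2_sq mulr_sumr.
apply: ler_sum => i _; rewrite ler_wpM2r ?sqr_ge0//.
rewrite ler_pXn2r ?nnegrE ?sigma_min_ge0//; last by have [] := dM i.
exact: ge_inf (has_lbound_singular_values _ _) _ (dM i).
Qed.

Lemma sigma_max_ge n (M : 'M[R[i]]_n) (y : 'cV_n) :
  norm2 (M *m y) <= sigma_max M * norm2 y.
Proof.
have [P [d [PP dM Md]]] := singular_decomposition n M.
have dmax i : 0 <= d i <= sigma_max M.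
  have [-> _] := dM i.
  exact: ub_le_sup (has_ubound_singular_values _ _) _ (dM i).
have [y0|y0] := eqVneq y 0; first by rewrite y0 mulmx0 norm2_0 mulr0.
(* Some [d i] must exist to bound [sigma_max] from below; a nonzero [y] excludes dimension 0. *)
have smax0 : 0 <= sigma_max M.
  case: n M y P d {PP dM Md} dmax y0 => [|n] M y P d dmax y0.
    by rewrite (flatmx0 y) eqxx in y0.
  by have /andP[/le_trans] := dmax ord0; apply.
rewrite -(@ler_pXn2r _ 2)// ?nnegrE ?mulr_ge0 ?norm2_ge0//.
rewrite Md exprMn -(norm2_isometry _ _ _ y PP) norm2_sq mulr_sumr.
apply: ler_sum => i _; rewrite ler_wpM2r ?sqr_ge0//.
by have /andP[d0 ds] := dmax i; rewrite ler_pXn2r ?nnegrE.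
Qed.

Lemma sigma_min_attained n (M : 'M[R[i]]_n) : (0 < n)%N ->
  exists2 w : 'cV[R[i]]_n, norm2 w = 1 & norm2 (M *m w) = sigma_min M.
Proof.
case: n M => // n M _.
have [P [d [PP dM Md]]] := singular_decomposition _ M.
have d0 i : 0 <= d i by have [] := dM i.
(* The least [d i] is a singular value, and no unit vector has an image of smaller norm. *)
pose i0 := [arg min_(i < ord0) d i]%O.
have di0 i : d i0 <= d i by rewrite /i0; case: arg_minP => // j _; exact.
suff -> : sigma_min M = d i0 by exact: singular_valueP.
apply/eqP; rewrite eq_le ge_inf//=; last exact: has_lbound_singular_values.
apply: lb_le_inf; first by exists (d i0).
move=> _ /singular_valueP[w w1 <-].
rewrite -(@ler_pXn2r _ 2)// ?nnegrE ?norm2_ge0// Md.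
rewrite -[X in X <= _]mulr1 -[X in _ * X](expr1n _ 2) -w1.
rewrite -(norm2_isometry _ _ _ w PP) norm2_sq mulr_sumr.
by apply: ler_sum => i _; rewrite ler_wpM2r ?sqr_ge0// ler_pXn2r ?nnegrE.
Qed.

(** In dimension 0 there is no unit vector, hence no singular value, and the [inf] of the empty set
    is 0. *)
Lemma sigma_min_gt0_dim n (M : 'M[R[i]]_n) : 0 < sigma_min M -> (0 < n)%N.
Proof.
case: n M => // M; rewrite /sigma_min.
rewrite (_ : singular_values M = set0) ?inf0 ?ltxx//.
apply/seteqP; split=> // s /singular_valueP[w w1 _].
by move/eqP: w1; rewrite (flatmx0 w) norm2_0 eq_sym oner_eq0.
Qed.

Lemma sigma_min_gt0 n (M : 'M[R[i]]_n) : (0 < n)%N ->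
  (forall y : 'cV_n, M *m y = 0 -> y = 0) -> 0 < sigma_min M.
Proof.
move=> n0 Minj; have [w w1 <-] := sigma_min_attained n M n0.
rewrite norm2_gt0; apply/eqP => /Minj w0.
by move/eqP: w1; rewrite w0 norm2_0 eq_sym oner_eq0.
Qed.


(** * Deflation and the basis formed by [xR] and the columns of [X] *)

Lemma deflated_blockE n k (A : 'M[R[i]]_n) (lambda : R[i]) (xL : 'cV[R[i]]_n)
    (X : 'M[R[i]]_(n, k)) (w : 'cV[R[i]]_k) :
  adjoint xL *m A = lambda *: adjoint xL -> orthonormal_columns X ->
  colspan X = orthogonal_complement xL ->
  A *m (X *m w) = X *m (deflated_block A X *m w).
Proof.
move=> xLA XX Xspan.
have : orthogonal_complement xL (X *m w) by rewrite -Xspan; exists w.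
rewrite /orthogonal_complement /= => xLX.
(* The orthogonal complement of a left eigenvector is invariant under [A]; orthonormality of [X]
   then identifies the coordinates [y]. *)
have [y _ Xy] : colspan X (A *m (X *m w)).
  by rewrite Xspan /orthogonal_complement /= mulmxA xLA -scalemxAl xLX scaler0.
by rewrite /deflated_block -!mulmxA -Xy (mulmxA _ X) XX mul1mx.
Qed.

Section Deflation.
Variables (n : nat) (A : 'M[R[i]]_n.+1) (lambda theta : R[i]).
Variables (xR xL : 'cV[R[i]]_n.+1) (X : 'M[R[i]]_(n.+1, n)).
Hypotheses (AxR : A *m xR = lambda *: xR) (xR1 : norm2 xR = 1).
Hypotheses (xLA : adjoint xL *m A = lambda *: adjoint xL).
Hypotheses (XX : orthonormal_columns X).
Hypotheses (Xspan : colspan X = orthogonal_complement xL).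
Let B := deflated_block A X.
Hypothesis gap : cmod (lambda - theta) < sigma_min (B - theta%:M).

Let AX (w : 'cV[R[i]]_n) : A *m (X *m w) = X *m (B *m w).
Proof. exact: (deflated_blockE _ _ _ lambda xL). Qed.

(** On such a [w], [B - theta%:M] acts as multiplication by [lambda - theta], whose modulus is below
    [sigma_min]. *)
Lemma deflated_eigenvalue_free (w : 'cV[R[i]]_n) :
  B *m w = lambda *: w -> w = 0.
Proof.
move=> Bw; apply/eqP; apply: contraTT gap => w0; rewrite -leNgt.
have : 0 < norm2 w by rewrite norm2_gt0.
move=> /ler_pM2r <-; rewrite -norm2Z scalerBl -Bw -mul_scalar_mx -mulmxBl.
exact: sigma_min_le.
Qed.

(** A linear relation makes [X *m y] a multiple of [xR], so that [y] satisfies the eigenvector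
    equation of [B] at [lambda] and vanishes by the gap; the coefficient of the unit vector [xR]
    then vanishes too. *)
Lemma eigenbasis_inj (z : 'cV[R[i]]_(1 + n)) : row_mx xR X *m z = 0 -> z = 0.
Proof.
rewrite -[z]vsubmxK mul_row_col; set a := usubmx z; set y := dsubmx z.
rewrite [a]mx11_scalar mul_mx_scalar; set b := a 0 0 => xy0.
have Xy : X *m y = - (b *: xR) by apply/eqP; rewrite -addr_eq0 addrC xy0.
have yE : y = - (b *: (adjoint X *m xR)).
  by rewrite scalemxAr -mulmxN -Xy mulmxA XX mul1mx.
have y0 : y = 0.
  apply: deflated_eigenvalue_free.
  have : adjoint X *m (X *m (B *m y)) = adjoint X *m (lambda *: (X *m y)).
    by rewrite -AX Xy mulmxN -scalemxAr AxR scalerN scalerA mulrC -scalerA.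
  by rewrite -scalemxAr !(mulmxA (adjoint X)) XX !mul1mx.
have b0 : b = 0.
  have /eqP := Xy; rewrite y0 mulmx0 eq_sym oppr_eq0 scaler_eq0.
  move=> /orP[/eqP//|].
  by rewrite -norm2_eq0 xR1 oner_eq0.
by rewrite y0 b0 raddf0 col_mx0.
Qed.

Lemma eigenbasis_decomposition (u : 'cV[R[i]]_n.+1) :
  exists a y, u = a *: xR + X *m y.
Proof.
(* The ascription reads the block matrix as square, so that injectivity gives invertibility; [det0P]
   yields a row vector, hence the passage to the transpose. *)
pose M : 'M[R[i]]_(1 + n) := row_mx xR X.
have Mu : M \in unitmx.
  rewrite -unitmx_tr unitmxE unitfE; apply/det0P => -[v v0 /(congr1 trmx)].
  rewrite trmx_mul trmxK trmx0 => /eigenbasis_inj vT.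
  by move/eqP: v0; apply; rewrite -[v]trmxK vT trmx0.
pose z : 'cV[R[i]]_(1 + n) := invmx M *m u.
exists (usubmx z 0 0), (dsubmx z).
rewrite -mul_mx_scalar -mx11_scalar -mul_row_col vsubmxK.
by rewrite /z mulKVmx.
Qed.

Lemma sigma_min_eigenbasis_gt0 : 0 < sigma_min (row_mx xR X : 'M[R[i]]_(1 + n)).
Proof. by apply: sigma_min_gt0 => //; exact: eigenbasis_inj. Qed.

Lemma sigma_max_eigenbasis_ge1 :
  1 <= sigma_max (row_mx xR X : 'M[R[i]]_(1 + n)).
Proof.
(* The first basis vector is mapped to [xR], of norm 1. *)
have := sigma_max_ge _ (row_mx xR X : 'M[R[i]]_(1 + n)) (col_mx 1%:M 0).
rewrite mul_row_col mulmx1 mulmx0 addr0 xR1.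
suff -> : norm2 (col_mx 1%:M 0 : 'cV[R[i]]_(1 + n)) = 1 by rewrite mulr1.
apply/eqP; rewrite -(@eqrXn2 _ 2)// ?norm2_ge0// norm2_col_mx norm2_0.
rewrite norm2_sq big_ord1 mxE /cmod ComplexField.Normc.normc1.
by rewrite !expr1n expr0n addr0.
Qed.

Lemma kappa2_eigenbasis_ge0 : 0 <= kappa2 (row_mx xR X : 'M[R[i]]_(1 + n)).
Proof.
rewrite divr_ge0 ?(ltW sigma_min_eigenbasis_gt0)//.
exact: le_trans ler01 sigma_max_eigenbasis_ge1.
Qed.

Lemma sin_angle_residual (u : 'cV[R[i]]_n.+1) : u != 0 ->
  sin_angle xR u <= kappa2 (row_mx xR X) *
    (norm2 ((A - theta%:M) *m u) / norm2 u / sigma_min (B - theta%:M)).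
Proof.
move=> u0; have [a [y uE]] := eigenbasis_decomposition u.
have delta0 : 0 < sigma_min (B - theta%:M) := le_lt_trans (cmod_ge0 _) gap.
have smin0 := sigma_min_eigenbasis_gt0.
have smax1 := sigma_max_eigenbasis_ge1.
have U0 : 0 < norm2 u by rewrite norm2_gt0.
set delta := sigma_min (B - _) in delta0 *.
set smin := sigma_min _ in smin0; set smax := sigma_max _ in smax1.
set r := norm2 ((A - theta%:M) *m u).
(* Choosing for [alpha] the coordinate of [u] along [xR] leaves [X *m y], which has the norm of
   [y]. *)
apply: le_trans (sin_angle_le _ _ _ a xR1 u0) _.
have -> : norm2 (u - a *: xR) = norm2 y.
  by rewrite uE addrC addKr norm2_isometry.
(* In the basis, the residual has coordinates [z]; its component along [xR] is discarded, and
   [sigma_min] is used once for the basis and once for [B - theta%:M]. *)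
have yr : smin * (delta * norm2 y) <= r.
  pose z : 'cV[R[i]]_(1 + n) :=
    col_mx ((a * (lambda - theta))%:M) ((B - theta%:M) *m y).
  have -> : r = norm2 ((row_mx xR X : 'M[R[i]]_(1 + n)) *m z).
    rewrite mul_row_col mul_mx_scalar /r uE mulmxDr -scalemxAr !mulmxBl AxR AX.
    by rewrite !mul_scalar_mx -scalerBl scalerA mulmxBr -scalemxAr.
  apply: le_trans (sigma_min_le _ _ _).
  rewrite ler_pM2l//; apply: le_trans (sigma_min_le _ _ _) _.
  rewrite -(@ler_pXn2r _ 2)// ?nnegrE ?norm2_ge0//.
  by rewrite norm2_col_mx lerDr sqr_ge0.
rewrite (_ : kappa2 _ * _ = smax * (r / (smin * delta)) / norm2 u); last first.
  by rewrite /kappa2 -/smin -/smax; field; rewrite !gt_eqF.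
rewrite ler_pM2r ?invr_gt0//.
have : norm2 y <= r / (smin * delta).
  by rewrite ler_pdivlMr ?mulr_gt0// mulrC -mulrA.
(* The factor [smax], at least 1, turns the inverse of [smin] into the condition number. *)
move=> /le_trans; apply; rewrite ler_peMl// divr_ge0 ?norm2_ge0//.
by rewrite mulr_ge0// ltW.
Qed.

(** At a unit [w] minimizing the norm of [(B - theta%:M) *m w], replacing [theta] by [lambda]
    subtracts a vector of norm [cmod (lambda - theta)], which the gap bounds by the same minimum. *)
Lemma sigma_min_deflated_ge : (0 < n)%N ->
  sigma_min (B - lambda%:M) <= 2 * sigma_min (B - theta%:M).
Proof.
move=> n0; have [w w1 wE] := sigma_min_attained _ (B - theta%:M) n0.
have delta0 : 0 < sigma_min (B - theta%:M) := le_lt_trans (cmod_ge0 _) gap.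
have := sigma_min_le _ (B - lambda%:M) w; rewrite w1 mulr1 => /le_trans; apply.
have -> : (B - lambda%:M) *m w = (B - theta%:M) *m w - (lambda - theta) *: w.
  by rewrite !mulmxBl !mul_scalar_mx scalerBl opprB addrA subrK.
have := norm2_parallelogram _ ((B - theta%:M) *m w) ((lambda - theta) *: w).
rewrite norm2Z w1 mulr1 wE => par.
rewrite -(@ler_pXn2r _ 2)// ?nnegrE ?mulr_ge0 ?norm2_ge0 ?sigma_min_ge0//.
have c2 : cmod (lambda - theta) ^+ 2 <= sigma_min (B - theta%:M) ^+ 2.
  by rewrite ler_pXn2r ?nnegrE ?cmod_ge0 ?sigma_min_ge0// ltW.
have := sqr_ge0 (norm2 ((B - theta%:M) *m w + (lambda - theta) *: w)).
rewrite exprMn; lra.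
Qed.

End Deflation.

(** * The sketched minimizer against the unsketched minimum *)

Lemma min_on_sphere_ge0 m k (M : 'M[R[i]]_(m, k)) : 0 <= min_on_sphere M.
Proof.
rewrite /min_on_sphere; set E := (X in inf X).
have [->|/set0P E0] := eqVneq E set0; first by rewrite inf0.
by apply: lb_le_inf => // _ [c _ <-]; exact: norm2_ge0.
Qed.

(** The embedding is used three times: its lower bound on the residual at [c] and its upper bound on
    that at a competitor cost [sqrt (1 + eps) / sqrt (1 - eps)]; its upper bound on [V *m c], whose
    sketch has norm 1, costs another [sqrt (1 + eps)]. *)
Lemma sketched_residual_le s n k (S : 'M[R[i]]_(s, n)) (eps : R)
    (A : 'M[R[i]]_n) (theta : R[i]) (V : 'M[R[i]]_(n, k)) (c : 'cV[R[i]]_k) :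
  0 < eps < 1 -> sketch_orthonormal S V ->
  subspace_embedding S eps (colspan (row_mx V (A *m V))) ->
  argmin_on_sphere (S *m (A - theta%:M) *m V) c ->
  V *m c != 0 /\
  norm2 ((A - theta%:M) *m (V *m c)) / norm2 (V *m c) <=
    (1 + eps) / Num.sqrt (1 - eps) * min_on_sphere ((A - theta%:M) *m V).
Proof.
move=> /andP[eps0 eps1] SV emb [c1 cmin].
have e1 : 0 < 1 - eps by rewrite subr_gt0.
have e2 : 0 < 1 + eps by lra.
have embV :
    (1 - eps) * norm2 (V *m c) ^+ 2 <= 1 <= (1 + eps) * norm2 (V *m c) ^+ 2.
  have := emb (V *m c); rewrite mulmxA.
  rewrite (norm2_isometry _ _ _ c SV) c1 expr1n; apply.
  by exists (col_mx c 0); rewrite // mul_row_col mulmx0 addr0.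
have embR c' : (1 - eps) * norm2 ((A - theta%:M) *m V *m c') ^+ 2 <=
    norm2 (S *m (A - theta%:M) *m V *m c') ^+ 2 <=
    (1 + eps) * norm2 ((A - theta%:M) *m V *m c') ^+ 2.
  (* The residual at [c'] lies in the embedded space, with coefficients [- theta *: c'] on [V] and
     [c'] on [A *m V]. *)
  rewrite -!(mulmxA S); apply: emb; exists (col_mx (- theta *: c') c') => //.
  rewrite mul_row_col addrC !mulmxBl mul_scalar_mx scaleNr mulmxN.
  by rewrite -scalemxAr -scalemxAl.
have Vc0 : V *m c != 0.
  apply: contraTneq (embV) => ->.
  by rewrite norm2_0 expr0n !mulr0 ler10 andbF.
split=> //; have U0 : 0 < norm2 (V *m c) by rewrite norm2_gt0.
rewrite mulmxA; set r := norm2 _; set U := norm2 _ in U0 embV *.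
have sq0 : 0 < Num.sqrt (1 - eps) by rewrite sqrtr_gt0.
have sp0 : 0 < Num.sqrt (1 + eps) by rewrite sqrtr_gt0.
have sqE := sqr_sqrtr (ltW e1); have spE := sqr_sqrtr (ltW e2).
have rmin : r * (Num.sqrt (1 - eps) / Num.sqrt (1 + eps)) <=
    min_on_sphere ((A - theta%:M) *m V).
  (* The vector [c] itself shows that the sphere is nonempty, so the [inf] is not a default
     value. *)
  apply: lb_le_inf; first by exists r, c.
  move=> _ [c' c'1 <-].
  rewrite mulrA ler_pdivrMr// -(@ler_pXn2r _ 2)// ?nnegrE
    ?mulr_ge0 ?norm2_ge0 ?(ltW sq0) ?(ltW sp0)//.
  rewrite !exprMn sqE spE mulrC [leRHS]mulrC.
  have /andP[h1 _] := embR c; have /andP[_ h2] := embR c'.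
  apply: (le_trans h1); apply: le_trans h2.
  by rewrite ler_pXn2r ?nnegrE ?norm2_ge0// cmin.
have Uinv : U^-1 <= Num.sqrt (1 + eps).
  rewrite -div1r ler_pdivrMr// -(@ler_pXn2r _ 2)// ?nnegrE
    ?mulr_ge0 ?(ltW U0) ?(ltW sp0)//.
  by rewrite expr1n exprMn spE; case/andP: embV.
apply: (@le_trans _ _ (r * Num.sqrt (1 + eps))).
  by rewrite ler_wpM2l ?norm2_ge0.
have -> : r * Num.sqrt (1 + eps) = (1 + eps) / Num.sqrt (1 - eps) *
    (r * (Num.sqrt (1 - eps) / Num.sqrt (1 + eps))).
  (* Only the factor [1 + eps] outside a root becomes a square, so that one root cancels. *)
  rewrite -{2}spE.
  by field; rewrite !gt_eqF.
by rewrite ler_wpM2l// divr_ge0// ltW.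
Qed.

(** * The angle bound and its limit along a sequence *)

Lemma inv_le_of_half_le (a b : R) :
  0 < a -> 0 < b -> a <= 2 * b -> b^-1 <= 2 / a.
Proof.
by move=> a0 b0 ab; rewrite ler_pdivlMr// mulrC ler_pdivrMr.
Qed.

Lemma sin_angle_ge0 n (x u : 'cV[R[i]]_n) : 0 <= sin_angle x u.
Proof.
rewrite divr_ge0 ?norm2_ge0// lb_le_inf//.
  by exists (norm2 (x - 0 *: u)), 0.
by move=> _ [t _ <-]; exact: norm2_ge0.
Qed.

End Euclidean.

Theorem lemma5p3 (R : realType) (n : nat) (A : 'M[R[i]]_n.+1) (lambda : R[i])
    (xR xL : 'cV[R[i]]_n.+1) (Xperp : 'M[R[i]]_(n.+1, n))
    (s : nat) (S : 'M[R[i]]_(s, n.+1)) (eps : R)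
    (hsimple : simple_eigenvalue A lambda)
    (hxR : A *m xR = lambda *: xR) (hxR1 : norm2 xR = 1)
    (hxL : adjoint xL *m A = lambda *: adjoint xL) (hxL1 : norm2 xL = 1)
    (hXorth : orthonormal_columns Xperp)
    (hXspan : colspan Xperp = orthogonal_complement xL)
    (heps : 0 < eps < 1) :
  (forall (k : nat) (theta : R[i]) (V : 'M[R[i]]_(n.+1, k)) (c : 'cV[R[i]]_k),
      cmod (lambda - theta) < sigma_min (deflated_block A Xperp - theta%:M) ->
      sketch_orthonormal S V ->
      subspace_embedding S eps (colspan (row_mx V (A *m V))) ->
      argmin_on_sphere (S *m (A - theta%:M) *m V) c ->
      sin_angle xR (V *m c) <=
        (1 + eps) / Num.sqrt (1 - eps) * kappa2 (row_mx xR Xperp) *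
        (min_on_sphere ((A - theta%:M) *m V) /
         sigma_min (deflated_block A Xperp - theta%:M)))
  /\
  (forall (k : nat -> nat) (theta : nat -> R[i])
      (V : forall m : nat, 'M[R[i]]_(n.+1, k m))
      (c : forall m : nat, 'cV[R[i]]_(k m)),
      (forall m : nat,
        [/\ cmod (lambda - theta m) <
              sigma_min (deflated_block A Xperp - (theta m)%:M),
            sketch_orthonormal S (V m),
            subspace_embedding S eps (colspan (row_mx (V m) (A *m V m))) &
            argmin_on_sphere (S *m (A - (theta m)%:M) *m V m) (c m)]) ->
      (fun m : nat => min_on_sphere ((A - (theta m)%:M) *m V m))
        @ \oo --> (0 : R) ->
      (fun m : nat => sin_angle xR (V m *m c m)) @ \oo --> (0 : R)).
Proof.
have e1 : 0 < 1 - eps by case/andP: heps => _; rewrite subr_gt0.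
have e2 : 0 < 1 + eps by case/andP: heps => e0 _; rewrite addr_gt0.
pose B := deflated_block A Xperp; pose K := (1 + eps) / Num.sqrt (1 - eps).
have K0 : 0 <= K by rewrite divr_ge0 ?sqrtr_ge0// ltW.
have bound k theta (V : 'M[R[i]]_(n.+1, k)) c :
    cmod (lambda - theta) < sigma_min (B - theta%:M) ->
    sketch_orthonormal S V ->
    subspace_embedding S eps (colspan (row_mx V (A *m V))) ->
    argmin_on_sphere (S *m (A - theta%:M) *m V) c ->
    sin_angle xR (V *m c) <= K * kappa2 (row_mx xR Xperp) *
      (min_on_sphere ((A - theta%:M) *m V) / sigma_min (B - theta%:M)).
  move=> gap SV emb cmin.
  have [Vc0 res] :=
    sketched_residual_le _ _ _ S eps A theta V c heps SV emb cmin.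
  have kappa0 :=
    kappa2_eigenbasis_ge0 _ _ _ _ _ _ _ hxR hxR1 hxL hXorth hXspan gap.
  have := sin_angle_residual _ _ _ _ _ _ _ hxR hxR1 hxL hXorth hXspan gap _ Vc0.
  move=> /le_trans; apply.
  rewrite [K * _]mulrC -[leRHS]mulrA ler_wpM2l// mulrA ler_wpM2r//.
  by rewrite invr_ge0 sigma_min_ge0.
split=> [|k theta V c hyps res0]; first exact: bound.
(* The gap at one index gives every fact free of [theta m]: positive dimension of the deflated
   block, [lambda] not an eigenvalue of it, and a nonnegative condition number. *)
have [gap _ _ _] := hyps 0.
have n0 : (0 < n)%N by apply: sigma_min_gt0_dim (le_lt_trans (cmod_ge0 _) gap).
have sigma0 : 0 < sigma_min (B - lambda%:M).
  apply: sigma_min_gt0 => // y; rewrite mulmxBl mul_scalar_mx => /eqP.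
  rewrite subr_eq0 => /eqP.
  exact: (deflated_eigenvalue_free _ _ _ _ _ gap).
have kappa0 :=
    kappa2_eigenbasis_ge0 _ _ _ _ _ _ _ hxR hxR1 hxL hXorth hXspan gap.
(* [C] is independent of [m]: the inverse of [sigma_min] at [theta m] is bounded by twice its
   inverse at [lambda]. *)
pose C := K * kappa2 (row_mx xR Xperp) * (2 / sigma_min (B - lambda%:M)).
apply: (@squeeze_cvgr _ _ _ _ (fun=> 0)
  (fun m => C * min_on_sphere ((A - (theta m)%:M) *m V m))).
- near=> m; rewrite sin_angle_ge0 /=.
  have [gapm SV emb cmin] := hyps m.
  apply: le_trans (bound _ _ _ _ gapm SV emb cmin) _.
  have delta0 := le_lt_trans (cmod_ge0 _) gapm.
  have dinv :
      (sigma_min (B - (theta m)%:M))^-1 <= 2 / sigma_min (B - lambda%:M).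
    apply: inv_le_of_half_le => //.
    exact: (sigma_min_deflated_ge _ _ _ _ _ gapm n0).
  rewrite /C -[leRHS]mulrA; apply: ler_wpM2l; first exact: mulr_ge0.
  by rewrite [leRHS]mulrC; apply: ler_wpM2l; first exact: min_on_sphere_ge0.
- exact: cvg_cst.
- by rewrite -[0 in X in _ --> X](mulr0 C); apply: cvgM => //; exact: cvg_cst.
Unshelve. all: by end_near. Qed.
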